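(* Let $\Phi$ be a Euclidean domain and let $\phi=(f_1,f_2)$ be a tame automorphism of the polynomial algebra $\Phi[x_1,x_2]$. If $$D(\phi)\succ (x_1,x_2,2e),$$ then $\phi$ is elementarily $D$-reducible.
   Context: A Euclidean domain here is a (commutative) integral domain $\Phi$ that is not a field, equipped with a function (norm) $|\cdot|:\Phi\setminus\{0\}\to\mathbb{Z}_+=\{0,1,2,\dots\}$ such that: (E1) for all $a,b\in\Phi\setminus\{0\}$, $|ab|\ge |a|$, with equality only when $b$ is invertible; (E2) for all $a,b\in\Phi$ with $b\ne 0$ there are $q,r\in\Phi$ with $a=bq+r$ and either $r=0$ or $|r|<|b|$. $\Phi^*$ denotes the set of invertible elements, and $e=|1|$. Automorphisms: $(f_1,f_2)$ denotes the $\Phi$-algebra automorphism $\phi$ of $\Phi[x_1,x_2]$ with $\phi(x_i)=f_i$. Elementary automorphisms are those of the form $(\alpha x_1+f(x_2),x_2)$ or $(x_1,\beta x_2+g(x_1))$ with $\alpha,\beta\in\Phi^*$ and $f,g$ polynomials over $\Phi$. An automorphism is tame if it lies in the subgroup of $\mathrm{Aut}(\Phi[x_1,x_2])$ generated by all elementary automorphisms. An elementary transformation of a pair $(f_1,f_2)$ replaces one element $f_i$ by $\alpha f_i+g$, where $\alpha\in\Phi^*$ and $g$ is in the subalgebra generated by the other element $f_j$, $j\neq i$ (i.e. $g$ is a polynomial over $\Phi$ in $f_j$). Write $(f_1,f_2)\to(g_1,g_2)$ if $(g_1,g_2)$ is obtained from $(f_1,f_2)$ by one elementary transformation. Order and exponent: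 let $W=\{x_1^l x_2^m\mid l,m\in\mathbb{Z}_+\}$, linearly ordered by: $u<v$ if $\deg u<\deg v$, or $\deg u=\deg v$ and $\deg_{x_1}u<\deg_{x_1}v$ (so $x_1>x_2$), where $\deg$ is total degree. For $0\ne f\in\Phi[x_1,x_2]$, $\overline{f}$ is the greatest monomial occurring in $f$ and $lc(f)\in\Phi\setminus\{0\}$ its coefficient. For an automorphism $\varphi=(f_1,f_2)$ put $D(\varphi)=(u,v,|lc(f_1)|+|lc(f_2)|)\in W^2\times\mathbb{Z}_+$, where $\{u,v\}=\{\overline{f_1},\overline{f_2}\}$ and $u\ge v$. The set $W^2\times\mathbb{Z}_+$ is linearly ordered by the lexicographic order $\preceq$ (with strict versions $\prec,\succ$). An automorphism $\theta$ is elementarily $D$-reducible if there is an automorphism $\psi$ with $\theta\to\psi$ and $D(\psi)\prec D(\theta)$. *)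

(* Defs.v *)
From HB Require Import structures.
From mathcomp Require Import all_boot all_order all_algebra.
From mathcomp Require Export mpoly.

Set Implicit Arguments.
Unset Strict Implicit.
Unset Printing Implicit Defensive.

Import Order.TTheory GRing.Theory.
Local Open Scope ring_scope.

(* N plays the role of the norm |.|, which is only defined on nonzero elements:
   no condition is put on N 0. *)
Record euclidean_domain (R : idomainType) (N : R -> nat) : Prop := {
  euclid_not_field : exists2 a : R, a != 0 & a \isn't a GRing.unit;
  euclid_mul_ge : forall a b : R, a != 0 -> b != 0 -> (N a <= N (a * b)%R)%N;
  euclid_mul_eq : forall a b : R, a != 0 -> b != 0 ->
    N (a * b) = N a -> b \is a GRing.unit;
  euclid_div : forall a b : R, b != 0 ->
    exists q r : R, a = b * q + r /\ (r = 0 \/ (N r < N b)%N)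
}.

(* Indices start at 0, so x_1 and x_2 are 'X_ix1 and 'X_ix2. *)
Definition ix1 : 'I_2 := ord0.
Definition ix2 : 'I_2 := ord_max.

(* The automorphism (f_1, f_2) is the bijective algebra morphism phi with
   phi 'X_ix1 = f_1 and phi 'X_ix2 = f_2. *)
Notation endo R := {lrmorphism {mpoly R[2]} -> {mpoly R[2]}}.

Definition is_automorphism (R : idomainType) (phi : endo R) : Prop :=
  bijective phi.

(* horner_alg h f is the value f(h) of f : {poly R} at h : {mpoly R[2]}. *)
Definition elementary (R : idomainType) (phi : endo R) : Prop :=
  (exists (a : R) (f : {poly R}), [/\ a \is a GRing.unit,
     phi 'X_ix1 = a *: 'X_ix1 + horner_alg 'X_ix2 f & phi 'X_ix2 = 'X_ix2]) \/
  (exists (b : R) (g : {poly R}), [/\ b \is a GRing.unit,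
     phi 'X_ix1 = 'X_ix1 & phi 'X_ix2 = b *: 'X_ix2 + horner_alg 'X_ix1 g]).

(* The subgroup generated by the elementary automorphisms; the last clause
   closes it under inverses. *)
Inductive tame (R : idomainType) : endo R -> Prop :=
| tame_elementary (phi : endo R) : elementary phi -> tame phi
| tame_id : tame (idfun : {mpoly R[2]} -> {mpoly R[2]})
| tame_comp (phi psi : endo R) : tame phi -> tame psi -> tame (phi \o psi)
| tame_inv (phi psi : endo R) :
    tame phi -> cancel phi psi -> cancel psi phi -> tame psi.

(* The relation theta -> psi; the values horner_alg (theta 'X_j) g are exactly
   the elements of the subalgebra generated by theta 'X_j. *)
Definition elementary_transformation (R : idomainType) (theta psi : endo R) :
    Prop :=
  exists i j : 'I_2, i != j /\
  exists (a : R) (g : {poly R}), [/\ a \is a GRing.unit,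
    psi 'X_i = a *: theta 'X_i + horner_alg (theta 'X_j) g &
    psi 'X_j = theta 'X_j].

(* The library order on 'X_{1..2} compares total degrees first and then the
   exponents of x_1. *)
Lemma lt_monomE (u v : 'X_{1..2}) :
  (u < v)%O = (mdeg u < mdeg v)%N ||
              (mdeg u == mdeg v) && (u ix1 < v ix1)%N.
Proof.
case: (ltngtP (mdeg u) (mdeg v)) => [|/lt_mdeg_ltmc/ltW|eq_deg] /=.
- exact: lt_mdeg_ltmc.
- by rewrite leNgt => /negbTE.
apply/idP/idP => [/(ltmcP eq_deg)[i eq_lt lt_i]|lt1]; last first.
  by apply/(ltmcP eq_deg); exists ix1 => // k; rewrite ltn0.
case: (unliftP ord0 i) lt_i eq_lt => [k ->|-> //] lt2 /(_ ix1 isT) eq1.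
move: eq_deg lt2; rewrite (ord1 k) !mdegE !big_ord_recl !big_ord0 eq1 !addn0.
by rewrite -[v ord0]/(v ix1) => /addnI ->; rewrite !ltnn.
Qed.

(* *l is the product with the lexicographic order. *)
Notation Dtype := (('X_{1..2} *l 'X_{1..2}) *l nat)%type.

Definition D (R : idomainType) (N : R -> nat) (phi : endo R) : Dtype :=
  let f1 := phi 'X_ix1 in let f2 := phi 'X_ix2 in
  (Order.max (mlead f1) (mlead f2), Order.min (mlead f1) (mlead f2),
   (N (mleadc f1) + N (mleadc f2))%N).

Definition elementarily_D_reducible (R : idomainType) (N : R -> nat)
    (theta : endo R) : Prop :=
  exists psi : endo R, [/\ is_automorphism psi,
    elementary_transformation theta psi & (D N psi < D N theta)%O].

(* Main.v *)
Require Import Defs.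
From HB Require Import structures.
From mathcomp Require Import all_boot all_order all_algebra ring.
Import Order.TTheory GRing.Theory.
Local Open Scope ring_scope.

(** The pair of images of the variables under a tame automorphism arises from
    (x_1, x_2) by elementary transformations. Group them into alternating
    invertible affine changes and shears (p, q) -> (p + g(q), q) with
    deg g >= 2. Two consecutive shears in the same direction merge, and a shear
    by a g of degree at most 1 is affine, so every such pair is an affine image
    of a reduced pair (h1, h2): either the variables themselves, or the result
    of a shear applied to an affine image (p, q) of an earlier reduced pair,
    with deg p <= deg q. This normal form ([tame_tame_pair], whose core is
    [tame_pair_shear]) plays the role of the amalgamated product structure of
    the tame group, and it suffices here because the invertible affine changes
    are kept as arbitrary matrices and need not be factored.

    A reduced pair satisfies h2 < h1 for leading monomials. Let
    f1 = a h1 + b h2 + s and f2 = c h1 + d h2 + t. If a and c are both nonzero,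
    f1 and f2 have the same leading monomial, and a Euclidean division of one
    leading coefficient by the other lowers either a leading monomial or a norm
    ([euclid_lower]). If c = 0, then a and d are units ([tame_pair_descent]):
    over the variables this forces D = (x_1, x_2, 2e), and otherwise f1 is
    p + G(f2) for some polynomial G, up to rescaling p, so that subtracting
    G(f2) undoes the last shear and lowers the larger leading monomial. The
    case a = 0 is symmetric.

    The Euclidean division is applied to the leading coefficients themselves
    and not to a and c, since the norm need not be multiplicative. *)

Set Implicit Arguments.
Unset Strict Implicit.
Unset Printing Implicit Defensive.

Section TamePairs.

Context (R : idomainType).
Implicit Types (f h p q : {mpoly R[2]}) (g : {poly R}) (a b c d : R).

Local Notation X1 := ('X_ix1 : {mpoly R[2]}).
Local Notation X2 := ('X_ix2 : {mpoly R[2]}).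

(** * Polynomial values *)

Lemma horner_alg_comp p g1 g2 :
  horner_alg p (g1 \Po g2) = horner_alg (horner_alg p g2) g1.
Proof.
elim/poly_ind: g1 => [|g1 c IH]; first by rewrite comp_poly0 !raddf0.
rewrite comp_polyD comp_polyM comp_polyX comp_polyC.
by rewrite !rmorphD !rmorphM /= IH !horner_algX !horner_algC.
Qed.

Lemma horner_algZ a p g : horner_alg p (a *: g) = a *: horner_alg p g.
Proof. by rewrite -mul_polyC rmorphM /= horner_algC mulr_algl. Qed.

Lemma horner_alg_linear p g : (size g <= 2)%N ->
  horner_alg p g = g`_1 *: p + (g`_0)%:A.
Proof.
move=> sz_g; have {1}-> : g = g`_1 *: 'X + (g`_0)%:P.
  apply/polyP => -[|[|i]]; rewrite !(coefD, coefZ, coefX, coefC) /=; [ring|ring|].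
  by rewrite mulr0 addr0 nth_default // (leq_trans sz_g).
by rewrite rmorphD /= horner_algZ horner_algX horner_algC.
Qed.

Lemma mleadZ_unit a p : a \is a GRing.unit -> mlead (a *: p) = mlead p.
Proof. by move=> Ua; apply: mleadZ; apply: contraTneq Ua => ->; rewrite unitr0. Qed.

Lemma mdeg_mlead_neq0 p : (0 < mdeg (mlead p))%N -> p != 0.
Proof. by apply: contraTneq => ->; rewrite mlead0 mdeg0. Qed.

(** Over a domain the top term of g(p) comes from the top term of g alone. The
    nonvanishing of g(p) is carried along because the leading monomial of 0 is
    that of a nonzero constant. *)
Lemma mdeg_mlead_horner_alg p g : (0 < mdeg (mlead p))%N -> g != 0 ->
  horner_alg p g != 0 /\
  mdeg (mlead (horner_alg p g)) = (mdeg (mlead p) * (size g).-1)%N.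
Proof.
move=> deg_p; have p0 := mdeg_mlead_neq0 deg_p.
elim/poly_ind: g => [|g c IH] gc0; first by rewrite eqxx in gc0.
rewrite rmorphD rmorphM /= horner_algX horner_algC alg_mpolyC size_MXaddC.
have [g0|g0] := eqVneq g 0.
  move: gc0; rewrite g0 mul0r add0r polyC_eq0 => /negPf c0.
  by rewrite raddf0 mul0r add0r c0 mpolyC_eq0 c0 mleadC mdeg0 size_poly0 /= muln0.
have {IH}[h0 deg_h] := IH g0; set h := horner_alg p g in h0 deg_h *.
have sz_g : (0 < size g)%N by rewrite size_poly_gt0.
have deg_hp : mdeg (mlead (h * p)) = (mdeg (mlead p) * size g)%N.
  by rewrite mleadM // mdegD deg_h -mulnSr prednK.
have lead_eq : mlead (h * p + c%:MP) = mlead (h * p).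
  by apply: mleadDl; apply: lt_mdeg_ltmc; rewrite mleadC mdeg0 deg_hp muln_gt0 deg_p.
split; last by rewrite lead_eq /= deg_hp.
by apply: mdeg_mlead_neq0; rewrite lead_eq deg_hp muln_gt0 deg_p.
Qed.

Lemma mlead_affine a b c p q :
  (mlead q < mlead p)%O -> a != 0 ->
  mlead (a *: p + b *: q + c%:A) = mlead p /\
  mleadc (a *: p + b *: q + c%:A) = a * mleadc p.
Proof.
move=> lt_qp a0; have lt_rp : (mlead (b *: q + c%:A) < mlead p)%O.
  apply: le_lt_trans (mleadD_le _ _) _.
  rewrite joinEtotal gt_max (le_lt_trans (mleadZ_le _ _) lt_qp) alg_mpolyC mleadC.
  exact: le_lt_trans (le0x _) lt_qp.
have lead_eq : mlead (a *: p + (b *: q + c%:A)) = mlead p.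
  by rewrite mleadDl mleadZ.
by rewrite -addrA lead_eq mcoeffD mcoeffZ (mcoeff_gt_mlead lt_rp) addr0.
Qed.

(** The analogue of [mlead_affine] when the larger polynomial is absent; there
    positivity of the degree keeps the constant from interfering. *)
Lemma mlead_affine1 a c p :
  (0 < mdeg (mlead p))%N -> a != 0 ->
  mlead (a *: p + c%:A) = mlead p /\ mleadc (a *: p + c%:A) = a * mleadc p.
Proof.
move=> deg_p; have lt0p : (mlead (0 : {mpoly R[2]}) < mlead p)%O.
  by apply: lt_mdeg_ltmc; rewrite mlead0 mdeg0.
by have := @mlead_affine a 0 c p 0 lt0p; rewrite scaler0 addr0.
Qed.

(** * Affine changes and reduced pairs *)

(** The constants s and t cannot be dropped: translations do not commute with
    shears. *)
Definition affine_change h1 h2 p q : Prop :=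
  exists a b c d s t : R, [/\ a * d - b * c \is a GRing.unit,
    p = a *: h1 + b *: h2 + s%:A & q = c *: h1 + d *: h2 + t%:A].

Lemma affine_change_trans h1 h2 k1 k2 p q :
  affine_change h1 h2 k1 k2 -> affine_change k1 k2 p q ->
  affine_change h1 h2 p q.
Proof.
move=> [a [b [c [d [s [t [U1 -> ->]]]]]]] [a' [b' [c' [d' [s' [t' [U2 -> ->]]]]]]].
exists (a' * a + b' * c), (a' * b + b' * d), (c' * a + d' * c), (c' * b + d' * d).
exists (a' * s + b' * t + s'), (c' * s + d' * t + t').
rewrite !alg_mpolyC -!mul_mpolyC !(mpolyCD, mpolyCM); split; [|ring|ring].
have -> : (a' * a + b' * c) * (c' * b + d' * d) -
          (a' * b + b' * d) * (c' * a + d' * c) =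
          (a * d - b * c) * (a' * d' - b' * c') by ring.
by rewrite unitrM U1.
Qed.

Lemma affine_change_swap h1 h2 p q :
  affine_change h1 h2 p q -> affine_change h1 h2 q p.
Proof.
move=> [a [b [c [d [s [t [U -> ->]]]]]]]; exists c, d, a, b, t, s; split=> //.
by rewrite -unitrN; have -> : - (c * b - d * a) = a * d - b * c by ring.
Qed.

Lemma affine_change_triangular a d g t p q :
  a \is a GRing.unit -> d \is a GRing.unit -> (size g <= 2)%N ->
  affine_change p q (a *: p + horner_alg q g) (d *: q + t%:A).
Proof.
move=> Ua Ud /horner_alg_linear ->; exists a, g`_1, 0, d, g`_0, t.
by rewrite mulr0 subr0 unitrM Ua scale0r add0r addrA.
Qed.

(** The bound deg p <= deg q says that (p, q) is not itself the outcome of a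
    shear in the direction of g, so that the shear by g, of degree at least 2,
    dominates p. For the initial pair of variables it holds as an equality of
    degrees, which is why degrees are compared and not monomials. *)
Inductive reduced : {mpoly R[2]} -> {mpoly R[2]} -> Prop :=
| reduced_vars : reduced X1 X2
| reduced_shear h1 h2 p q g :
    reduced h1 h2 -> affine_change h1 h2 p q ->
    (mdeg (mlead p) <= mdeg (mlead q))%N -> (2 < size g)%N ->
    reduced (p + horner_alg q g) q.

Definition tame_pair f1 f2 : Prop :=
  exists h1 h2, reduced h1 h2 /\ affine_change h1 h2 f1 f2.

Lemma tame_pair_swap f1 f2 : tame_pair f1 f2 -> tame_pair f2 f1.
Proof. by move=> [h1 [h2 [Rh /affine_change_swap]]]; exists h1, h2. Qed.

Lemma tame_pair_affine p q f1 f2 :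
  tame_pair p q -> affine_change p q f1 f2 -> tame_pair f1 f2.
Proof.
by move=> [h1 [h2 [Rh A1]]] /(affine_change_trans A1); exists h1, h2.
Qed.

Lemma reduced_tame_pair h1 h2 : reduced h1 h2 -> tame_pair h1 h2.
Proof.
move=> Rh; exists h1, h2; split=> //; exists 1, 0, 0, 1, 0, 0.
by rewrite mulr0 mulr1 subr0 unitr1 !scale0r !scale1r !addr0 add0r.
Qed.

Lemma affine_change_row_neq0 a b c d :
  a * d - b * c \is a GRing.unit -> (c != 0) || (d != 0).
Proof.
rewrite -negb_and; apply: contraTN => /andP[/eqP-> /eqP->].
by rewrite !mulr0 subr0 unitr0.
Qed.

Lemma mdeg_mlead_shear p q g :
  (0 < mdeg (mlead q))%N -> (mdeg (mlead p) <= mdeg (mlead q))%N ->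
  (2 < size g)%N ->
  (mdeg (mlead q) < mdeg (mlead (p + horner_alg q g)))%N.
Proof.
move=> deg_q le_pq sz_g.
have g0 : g != 0 by rewrite -size_poly_gt0 (ltn_trans _ sz_g).
have [_ deg_gq] := mdeg_mlead_horner_alg deg_q g0.
have lt_q_gq : (mdeg (mlead q) < mdeg (mlead (horner_alg q g)))%N.
  rewrite deg_gq -[X in (X < _)%N]muln1 ltn_pmul2l // -ltnS prednK //.
  exact: ltn_trans sz_g.
by rewrite mleadDr //; apply: lt_mdeg_ltmc; apply: leq_ltn_trans lt_q_gq.
Qed.

(** An affine combination q of (h1, h2) with a nonzero linear part leads with
    h1 or h2, hence is not constant, and g(q) then dominates q and p. *)
Lemma reduced_lead h1 h2 : reduced h1 h2 ->
  (0 < mdeg (mlead h2))%N /\ (mlead h2 < mlead h1)%O.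
Proof.
elim=> {h1 h2} [|h1 h2 p q g _ [deg_h2 lt_h21] [a [b [c [d [s [t [U _ ->]]]]]]]].
  by rewrite !mleadXm mdeg1 lt_monomE !mdeg1 !mnm1E.
set q' := c *: _ + _ + _ => le_pq sz_g.
suff deg_q : (0 < mdeg (mlead q'))%N.
  by split=> //; apply/lt_mdeg_ltmc/mdeg_mlead_shear.
have [c0|c0] := eqVneq c 0; last first.
  rewrite (mlead_affine _ _ lt_h21 c0).1.
  by apply: leq_trans deg_h2 _; apply/lemc_mdeg/ltW.
have := affine_change_row_neq0 U; rewrite c0 eqxx /= => d0.
by rewrite /q' c0 scale0r add0r (mlead_affine1 _ deg_h2 d0).1.
Qed.

(** If the first leading monomial is the larger one, the affine change must be
    triangular. Either it acts on the variables, or f1 is obtained from a pair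
    (p, f2) of no larger degree than f2 by adding a polynomial in f2. *)
Lemma tame_pair_descent f1 f2 :
  tame_pair f1 f2 -> (mlead f2 < mlead f1)%O ->
  [/\ mlead f1 = U_(ix1)%MM, mlead f2 = U_(ix2)%MM,
      mleadc f1 \is a GRing.unit & mleadc f2 \is a GRing.unit] \/
  (mdeg (mlead f2) < mdeg (mlead f1))%N /\
  exists p g, [/\ tame_pair p f2, (mdeg (mlead p) <= mdeg (mlead f2))%N &
                 f1 = p + horner_alg f2 g].
Proof.
move=> [h1 [h2 [Rh [a [b [c [d [s [t [U Ef1 Ef2]]]]]]]]]] lt_f21.
have [deg_h2 lt_h21] := reduced_lead Rh.
have c0 : c = 0.
  apply: contraTeq lt_f21 => c0; rewrite -leNgt Ef1 Ef2.
  (* If c != 0, f2 leads with h1, the largest monomial available to f1. *)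
  rewrite (mlead_affine _ _ lt_h21 c0).1.
  have [->|a0] := eqVneq a 0; last by rewrite (mlead_affine _ _ lt_h21 a0).1.
  rewrite scale0r add0r; have [->|b0] := eqVneq b 0.
    by rewrite scale0r add0r alg_mpolyC mleadC le0x.
  by rewrite (mlead_affine1 _ deg_h2 b0).1 ltW.
move: U Ef2; rewrite c0 mulr0 subr0 unitrM scale0r add0r => /andP[Ua Ud] Ef2.
have unit_neq0 (u : R) : u \is a GRing.unit -> u != 0.
  by apply: contraTneq => ->; rewrite unitr0.
have [lead_f1 leadc_f1] := mlead_affine b s lt_h21 (unit_neq0 _ Ua).
have [lead_f2 leadc_f2] := mlead_affine1 t deg_h2 (unit_neq0 _ Ud).
rewrite -Ef1 in lead_f1 leadc_f1; rewrite -Ef2 in lead_f2 leadc_f2.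
case: h1 h2 / Rh Ef1 Ef2 lead_f1 lead_f2 leadc_f1 leadc_f2 deg_h2 {lt_h21}.
  move=> _ _; rewrite !mleadXm !mcoeffX !eqxx !mulr1 => -> -> -> -> _.
  by left.
move=> k1 k2 p q g0 Rk Apq le_pq sz_g Ef1 Ef2 lead_f1 lead_f2 _ _ deg_q; right.
rewrite lead_f1 lead_f2; split; first exact: mdeg_mlead_shear.
(* r inverts the affine map sending q to f2, i.e. q = r(f2). *)
pose r : {poly R} := d^-1 *: ('X - t%:P).
exists (a *: p), ((a *: g0 + b *: 'X + s%:P) \Po r); split.
- apply: (@tame_pair_affine p q); first by exists k1, k2.
  have := @affine_change_triangular a d 0 t p q Ua Ud.
  by rewrite raddf0 addr0 size_poly0 -Ef2; apply.
- by rewrite mleadZ_unit.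
have -> : horner_alg f2 ((a *: g0 + b *: 'X + s%:P) \Po r) =
    a *: horner_alg q g0 + b *: q + s%:A.
  have Er : horner_alg f2 r = q.
    rewrite horner_algZ rmorphB /= horner_algX horner_algC Ef2 addrK.
    by rewrite scalerA mulVr // scale1r.
  by rewrite horner_alg_comp Er !rmorphD /= !horner_algZ horner_algX horner_algC.
by rewrite Ef1 scalerDr !addrA.
Qed.

(** The shear starts a new level of the normal form when deg f1 <= deg f2.
    Otherwise f1 = p + g1(f2) already ends with a shear in the same direction,
    and the two merge into the shear of p by a g1 + g, which may have degree at
    most 1 and then is absorbed into the affine part. *)
Lemma tame_pair_shear a g f1 f2 : a \is a GRing.unit ->
  tame_pair f1 f2 -> tame_pair (a *: f1 + horner_alg f2 g) f2.
Proof.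
move=> Ua.
have scale_pair p u : u \is a GRing.unit -> tame_pair p f2 -> tame_pair (u *: p) f2.
  move=> Uu /tame_pair_affine; apply.
  have := @affine_change_triangular u 1 0 0 p f2 Uu (unitr1 _).
  by rewrite raddf0 scale1r scale0r !addr0 size_poly0; apply.
have shear_low p g1 : tame_pair p f2 -> (mdeg (mlead p) <= mdeg (mlead f2))%N ->
    tame_pair (p + horner_alg f2 g1) f2.
  move=> Tp le_p; have [sz_g|sz_g] := leqP (size g1) 2.
    apply: tame_pair_affine Tp _.
    have := @affine_change_triangular 1 1 g1 0 p f2 (unitr1 _) (unitr1 _) sz_g.
    by rewrite !scale1r scale0r addr0.
  have [h1 [h2 [Rh Ah]]] := Tp.
  exact/reduced_tame_pair/reduced_shear/sz_g/le_p/Ah.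
move=> Tf; have [le_f|lt_f] := leqP (mdeg (mlead f1)) (mdeg (mlead f2)).
  by apply: shear_low; [exact: scale_pair | rewrite mleadZ_unit].
case: (tame_pair_descent Tf (lt_mdeg_ltmc lt_f)) => [[lf1 lf2 _ _]|].
  by rewrite lf1 lf2 !mdeg1 in lt_f.
move=> [_ [p [g1 [Tp le_p ->]]]].
have -> : a *: (p + horner_alg f2 g1) + horner_alg f2 g =
    a *: p + horner_alg f2 (a *: g1 + g).
  by rewrite rmorphD /= horner_algZ scalerDr addrA.
by apply: shear_low; [exact: scale_pair | rewrite mleadZ_unit].
Qed.

Lemma tame_pair_shear_inv a g f1 f2 : a \is a GRing.unit ->
  tame_pair (a *: f1 + horner_alg f2 g) f2 -> tame_pair f1 f2.
Proof.
move=> Ua /(@tame_pair_shear a^-1 (- (a^-1 *: g))); rewrite unitrV => /(_ Ua).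
rewrite scalerDr scalerA mulVr // scale1r rmorphN /= horner_algZ.
by rewrite addrK.
Qed.

(** * Lowering [D] *)

Definition pairD (N : R -> nat) f1 f2 : Dtype :=
  (Order.max (mlead f1) (mlead f2), Order.min (mlead f1) (mlead f2),
   (N (mleadc f1) + N (mleadc f2))%N).

Lemma pairD_swap N f1 f2 : pairD N f1 f2 = pairD N f2 f1.
Proof. by rewrite /pairD maxC minC addnC. Qed.

Lemma ltD_max N f1 f2 k1 k2 :
  (Order.max (mlead f1) (mlead f2) < Order.max (mlead k1) (mlead k2))%O ->
  (pairD N f1 f2 < pairD N k1 k2)%O.
Proof. 
by move=> lt_max; rewrite /pairD !ltxi_pair !lexi_pair (ltW lt_max) leNgt lt_max.
Qed.

Lemma ltD_min N k f1 f2 :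
  (mlead k < mlead f1)%O -> (mlead f1 = mlead f2) ->
  (pairD N k f2 < pairD N f1 f2)%O.
Proof.
move=> lt_k eq_lead; rewrite /pairD -eq_lead !ltxi_pair !lexi_pair maxxx minxx.
by rewrite (max_idPr (ltW lt_k)) (min_idPl (ltW lt_k)) lexx (ltW lt_k) leNgt lt_k.
Qed.

Lemma ltD_coef N k f1 f2 :
  mlead k = mlead f1 -> (N (mleadc k) < N (mleadc f1))%N ->
  (pairD N k f2 < pairD N f1 f2)%O.
Proof.
move=> lead_k lt_k; rewrite /pairD !ltxi_pair !lexi_pair lead_k !lexx /=.
by rewrite ltEnat /= ltn_add2r -{1}lead_k.
Qed.

(** With mleadc f1 = mleadc f2 * u + r, the coefficient of f1 - u f2 at the
    common leading monomial is r: if r vanishes the minimum of the monomials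
    drops, and if not the norm of the coefficient does. *)
Lemma euclid_lower N f1 f2 : euclidean_domain N ->
  mlead f1 = mlead f2 -> (0%MM < mlead f2)%O ->
  (N (mleadc f2) <= N (mleadc f1))%N ->
  exists g, (pairD N (f1 + horner_alg f2 g) f2 < pairD N f1 f2)%O.
Proof.
move=> EN eq_lead lead_gt0 le_N.
have f2_0 : mleadc f2 != 0.
  by rewrite mleadc_eq0; apply: contraTneq lead_gt0 => ->; rewrite mlead0 ltxx.
have [u [r [Edv small_r]]] := euclid_div EN (mleadc f1) f2_0.
exists ((- u) *: 'X); rewrite horner_algZ horner_algX; set k := f1 + _.
have le_k : (mlead k <= mlead f1)%O.
  apply: le_trans (mleadD_le _ _) _.
  by rewrite joinEtotal ge_max lexx eq_lead mleadZ_le.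
have coef_k : k@_(mlead f1) = r.
  by rewrite mcoeffD mcoeffZ Edv eq_lead; ring.
move: le_k; rewrite le_eqVlt => /predU1P[lead_k|lt_k]; last exact: ltD_min.
apply: (ltD_coef _ lead_k); rewrite lead_k coef_k.
case: small_r => [r0|lt_r]; last exact: leq_trans le_N.
move/eqP: coef_k; rewrite r0 -lead_k mleadc_eq0 => /eqP k0.
by rewrite -eq_lead -lead_k k0 mlead0 ltxx in lead_gt0.
Qed.

Lemma euclid_unit N a : euclidean_domain N -> a \is a GRing.unit -> N a = N 1.
Proof.
move=> EN Ua; have a0 : a != 0 by apply: contraTneq Ua => ->; rewrite unitr0.
apply/eqP; rewrite eqn_leq -{2}[a]mul1r (euclid_mul_ge EN) ?oner_neq0 // andbT.
rewrite -(divrr Ua) (euclid_mul_ge EN) // invr_eq0 //.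
Qed.

(** Such a pair attains the excluded bound: all units have the norm of 1. *)
Lemma pairD_vars N f1 f2 : euclidean_domain N ->
  mlead f1 = U_(ix1)%MM -> mlead f2 = U_(ix2)%MM ->
  mleadc f1 \is a GRing.unit -> mleadc f2 \is a GRing.unit ->
  pairD N f1 f2 = (U_(ix1)%MM, U_(ix2)%MM, (2 * N 1%R)%N).
Proof.
move=> EN lf1 lf2 U1 U2.
have le_21 : (mlead f2 <= mlead f1)%O.
  by rewrite lf1 lf2 ltW // lt_monomE !mdeg1 !mnm1E.
rewrite /pairD (max_idPl le_21) (min_idPr le_21).
by rewrite (euclid_unit EN U1) (euclid_unit EN U2) lf1 lf2 mul2n -addnn.
Qed.

Lemma tame_pair_lower_gt N f1 f2 : euclidean_domain N -> tame_pair f1 f2 ->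
  (mlead f2 < mlead f1)%O ->
  (((U_(ix1)%MM, U_(ix2)%MM, (2 * N 1%R)%N) : Dtype) < pairD N f1 f2)%O ->
  exists g, (pairD N (f1 + horner_alg f2 g) f2 < pairD N f1 f2)%O.
Proof.
move=> EN Tf lt_f21.
case: (tame_pair_descent Tf lt_f21) => [[lf1 lf2 U1 U2]|].
  by rewrite (pairD_vars EN lf1 lf2 U1 U2) ltxx.
move=> [lt_deg [p [g [_ le_p Ef1]]]] _; exists (- g).
apply: ltD_max; rewrite {1}Ef1 rmorphN /= addrK (max_idPl (ltW lt_f21)).
by rewrite gt_max lt_f21 andbT lt_mdeg_ltmc // (leq_ltn_trans le_p).
Qed.

Lemma tame_pair_lower N f1 f2 : euclidean_domain N -> tame_pair f1 f2 ->
  (((U_(ix1)%MM, U_(ix2)%MM, (2 * N 1%R)%N) : Dtype) < pairD N f1 f2)%O ->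
  exists g, (pairD N (f1 + horner_alg f2 g) f2 < pairD N f1 f2)%O \/
            (pairD N (f2 + horner_alg f1 g) f1 < pairD N f1 f2)%O.
Proof.
move=> EN Tf ltD; have [lt12|lt21|eq12] := ltgtP (mlead f1) (mlead f2).
- rewrite pairD_swap in ltD *.
  by have [g lt_g] := tame_pair_lower_gt EN (tame_pair_swap Tf) lt12 ltD; exists g; right.
- by have [g lt_g] := tame_pair_lower_gt EN Tf lt21 ltD; exists g; left.
have lead_gt0 : (0%MM < mlead f2)%O.
  rewrite lt0x; apply: contraTneq ltD => lf2.
  have U1_gt0 : (U_(ix1)%MM <= \bot :> 'X_{1..2})%O = false.
    by rewrite lex0 -mdeg_eq0 mdeg1.
  by rewrite /pairD eq12 lf2 maxxx minxx -leNgt !lexi_pair U1_gt0 le0x.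
have [le_N|/ltnW le_N] := leqP (N (mleadc f2)) (N (mleadc f1)).
  by have [g lt_g] := euclid_lower EN eq12 lead_gt0 le_N; exists g; left.
rewrite -eq12 in lead_gt0; have [g lt_g] := euclid_lower EN (esym eq12) lead_gt0 le_N.
by exists g; right; rewrite (pairD_swap N f1).
Qed.

(** * Tame automorphisms *)

Lemma endo_horner_alg (theta : endo R) p g :
  theta (horner_alg p g) = horner_alg (theta p) g.
Proof.
elim/poly_ind: g => [|g c IH]; first by rewrite !raddf0.
by rewrite !rmorphD !rmorphM /= !horner_algX !horner_algC IH rmorph_alg.
Qed.

Lemma endo_ext (theta psi : endo R) :
  (forall i, theta 'X_i = psi 'X_i) -> theta =1 psi.
Proof.
move=> eqX p; rewrite [p]mpolyE !raddf_sum; apply: eq_bigr => m _.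
rewrite /= !linearZ /= mpolyXE_id !rmorph_prod /=; congr (_ *: _).
by apply: eq_bigr => i _; rewrite !rmorphXn /= eqX.
Qed.

(** Quantifying over theta turns composition into chaining of equivalences, and
    stating an equivalence makes the inverse case immediate. *)
Lemma tame_tame_pair (phi : endo R) : tame phi -> forall theta : endo R,
  tame_pair (theta 'X_ix1) (theta 'X_ix2) <->
  tame_pair (theta (phi 'X_ix1)) (theta (phi 'X_ix2)).
Proof.
elim=> {phi} [phi el_phi|//|phi psi _ IHphi _ IHpsi|phi psi _ IHphi phiK psiK] theta.
- case: el_phi => -[a [g [Ua -> ->]]]; rewrite rmorphD /= linearZ /= endo_horner_alg.
    by split; [apply: tame_pair_shear | apply: tame_pair_shear_inv].
  split=> /tame_pair_swap T; apply: tame_pair_swap; first exact: tame_pair_shear.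
  exact: tame_pair_shear_inv T.
- exact: iff_trans (IHphi theta) (IHpsi (theta \o phi)).
have := IHphi (theta \o psi); rewrite /= !phiK.
exact: iff_sym.
Qed.

Definition shear_endo (i j : 'I_2) g : {mpoly R[2]} -> {mpoly R[2]} :=
  comp_mpoly [tuple 'X_k + (if k == i then horner_alg 'X_j g else 0) | k < 2].

HB.instance Definition _ i j g := GRing.LRMorphism.on (shear_endo i j g).

Lemma shear_endoX i j g k :
  shear_endo i j g 'X_k = 'X_k + (if k == i then horner_alg 'X_j g else 0).
Proof. by rewrite /shear_endo comp_mpolyXU -tnth_nth tnth_mktuple. Qed.

Lemma shear_endoK i j g : i != j ->
  cancel (shear_endo i j g) (shear_endo i j (- g)).
Proof.
move=> ne_ij; apply: (@endo_ext (shear_endo i j (- g) \o shear_endo i j g) idfun) => k /=.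
rewrite shear_endoX rmorphD /= shear_endoX; case: eqP => _; last by rewrite raddf0 !addr0.
rewrite endo_horner_alg /= shear_endoX eq_sym (negPf ne_ij) addr0 rmorphN /=.
by rewrite addrNK.
Qed.

Lemma shear_endo_bij i j g : i != j -> bijective (shear_endo i j g).
Proof.
move=> ne_ij; exists (shear_endo i j (- g)); first exact: shear_endoK.
by rewrite -{2}[g]opprK; apply: shear_endoK.
Qed.

End TamePairs.

Theorem theorem2 (R : idomainType) (N : R -> nat) (phi : endo R) :
  euclidean_domain N ->
  is_automorphism phi -> tame phi ->
  (((U_(ix1)%MM, U_(ix2)%MM, (2 * N 1%R)%N) : Dtype) < D N phi)%O ->
  elementarily_D_reducible N phi.
Proof.
move=> EN bij_phi tame_phi ltD.
have Tf : tame_pair (phi 'X_ix1) (phi 'X_ix2).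
  apply/(tame_tame_pair tame_phi idfun)/reduced_tame_pair/reduced_vars.
have step i j g : i != j ->
    (D N (phi \o shear_endo i j g) < D N phi)%O -> elementarily_D_reducible N phi.
  move=> ne_ij lt_D; exists (phi \o shear_endo i j g); split=> //.
    by apply: bij_comp bij_phi _; apply: shear_endo_bij.
  exists i, j; split=> //; exists 1, g; split=> /=; rewrite ?unitr1 //.
    by rewrite shear_endoX eqxx rmorphD /= endo_horner_alg scale1r.
  by rewrite shear_endoX eq_sym (negPf ne_ij) addr0.
have [g [ltg|ltg]] := tame_pair_lower EN Tf ltD.
  apply: (step ix1 ix2 g isT); rewrite /D /= !shear_endoX /= addr0.
  by rewrite rmorphD /= endo_horner_alg.
apply: (step ix2 ix1 g isT); rewrite /D /= !shear_endoX /= addr0.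
by rewrite rmorphD /= endo_horner_alg -/(pairD N _ _) pairD_swap.
Qed.
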